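(* Let $I=[0,1]$. (i) If $f:I\to I$ is continuous and $(I,f)$ is topologically transitive, then $h_{A}(\hat f)=+\infty$ for any $A\in\mathcal{S}$. (ii) There exists a sequence $f_{0,\infty}=\{f_n\}_{n=0}^\infty$ of continuous self-maps of $I$ such that $(I,f_{0,\infty})$ is topologically transitive and $h_{A}(\hat f_{0,\infty})=0$ for some $A\in\mathcal{S}$.
   Context: $f_0^n=f_{n-1}\circ\cdots\circ f_0$, $f_0^0=\mathrm{id}$; for a single map $f$ take $f_n=f$ for all $n$. $(I,f_{0,\infty})$ is topologically transitive if for any nonempty open $U,V\subset I$ there is $n\ge1$ with $f_0^n(U)\cap V\ne\emptyset$. $\mathcal S$ is the set of strictly increasing sequences $A=\{a_i\}_{i\ge1}$ of nonnegative integers. For a compact metric space $Z$ and continuous self-maps $g_{0,\infty}$, $h_A(g_{0,\infty})=\sup_{\mathscr A}\limsup_{n\to\infty}\frac1n\log\mathcal N(\bigvee_{i=1}^n (g_0^{a_i})^{-1}\mathscr A)$ over finite open covers ($\bigvee$ = common refinement, $\mathcal N$ = minimal cardinality of a subcover). $\mathcal M(I)$ is the space of Borel probability measures on $I$ with the weak$^*$ topology (compact metric, e.g. via the Prohorov metric), and $\hat f_n(\mu)(B)=\mu(f_n^{-1}(B))$. *)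

(* Defs.v *)
From HB Require Import structures.
From mathcomp Require Import all_boot all_order all_algebra.
From mathcomp Require Import all_classical all_reals all_analysis.
Set Implicit Arguments. Unset Strict Implicit. Unset Printing Implicit Defensive.
Import Order.TTheory GRing.Theory Num.Theory.
Import numFieldNormedType.Exports.
Local Open Scope classical_set_scope.
Local Open Scope ring_scope.

Section Defs.
Variable R : realType.

Definition I01 : set R := `[0%R, 1%R].

Definition selfmapI (f : R -> R) : Prop :=
  {within I01, continuous f} /\ (forall x, I01 x -> I01 (f x)).

Fixpoint comp_seq {T : Type} (g : nat -> T -> T) (n : nat) : T -> T :=
  match n with
  | 0%N => id
  | m.+1 => g m \o comp_seq g m
  end.

Definition top_transitive (f : nat -> R -> R) : Prop :=
  forall O1 O2 : set R, open O1 -> open O2 ->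
    (O1 `&` I01) !=set0 -> (O2 `&` I01) !=set0 ->
    exists n : nat, (1 <= n)%N /\
      exists x, (O1 `&` I01) x /\ (O2 `&` I01) (comp_seq f n x).

(** Points of M(I): Borel probability measures on R concentrated on I,
    identified by their set functions. *)
Definition measI (P : probability R R) : Prop := P (~` I01) = 0%E.

Definition MI : set (set R -> \bar R) :=
  [set m | exists P : probability R R, measI P /\ m = (P : set R -> \bar R)].

Definition hat (f : R -> R) (m : set R -> \bar R) : set R -> \bar R :=
  fun B => m (I01 `&` f @^-1` B).

(** Weak* open sets of M(I) (relative to MI): U is open iff every
    mu in U has a basic weak* neighbourhood
    {nu : |int g_i dnu - int g_i dmu| < e, i < k} (g_i continuous on I)
    contained in U. *)
Definition wopen (U : set (set R -> \bar R)) : Prop :=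
  forall P : probability R R, measI P -> U (P : set R -> \bar R) ->
    exists (k : nat) (g : 'I_k -> R -> R) (e : R), 0 < e /\
      (forall i, {within I01, continuous (g i)}) /\
      forall Q : probability R R, measI Q ->
        (forall i, `| Rintegral Q I01 (g i) - Rintegral P I01 (g i) | < e) ->
        U (Q : set R -> \bar R).

Definition open_coverMI (A : set (set (set R -> \bar R))) : Prop :=
  finite_set A /\ (forall U, A U -> wopen U) /\ MI `<=` \bigcup_(U in A) U.

(** Common refinement  \/_{i=1}^n (phi^{a_i})^{-1} A  (a_i := a (i-1)). *)
Definition join_pre {X : Type} (A : set (set X)) (phi : nat -> X -> X)
    (a : nat -> nat) (n : nat) : set (set X) :=
  [set V | exists U : nat -> set X, (forall i, (i < n)%N -> A (U i)) /\
       V = \bigcap_(i in `I_n) ((comp_seq phi (a i)) @^-1` (U i))].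

Definition coverN {X : Type} (C : set (set X)) (S : set X) : \bar R :=
  ereal_inf [set (k%:R)%:E | k in
    [set k : nat | exists s : seq (set X), size s = k /\
        (forall V, V \in s -> C V) /\ S `<=` \bigcup_(V in [set V | V \in s]) V]].

Definition strict_incr (a : nat -> nat) : Prop := forall n, (a n < a n.+1)%N.

Definition seq_entropy (a : nat -> nat) (phi : nat -> (set R -> \bar R) -> (set R -> \bar R))
  : \bar R :=
  ereal_sup [set limn_esup (fun n : nat =>
        ((n%:R)^-1 * ln (fine (coverN (join_pre A phi a n) MI)))%:E)
     | A in open_coverMI].

End Defs.

(* Main.v *)
(** (i) A transitive interval map [f] has a fixed point [p] in the interior. If
    some other interior point [y] is mapped to [p], then by transitivity a point
    between [y] and [p] is sent beyond [y] by an iterate, which therefore has a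
    horseshoe with two disjoint branches. Otherwise [f] exchanges [[0, p]] and
    [[p, 1]], [f^2] is transitive on [[0, p]] with an interior fixed point [q],
    and the same dichotomy applies to it; the second case is now impossible
    because [p] is fixed. Given a horseshoe of [f^k], all binary itineraries are
    realised at the times of [a] in a well-chosen residue class modulo [k], which
    makes up at least [1/k] of the times. With [K] equal point masses the mass of
    the left branch takes [K + 1] values, prescribed independently at those
    times, so the entropy is at least [ln (K + 1) / k] for every [K].

    (ii) The maps [h_t x = t x / (1 + (t - 1) x)] are alternated with their
    inverses [h_(1/t)], with [t] running through the positive rationals. At even times the composition is
    the identity, while [h_t u = v] is solvable for all rational [u], [v] in
    [(0, 1)]. *)

Require Import Defs.
From HB Require Import structures.
From mathcomp Require Import all_boot all_order all_algebra.
From mathcomp Require Import all_classical all_reals all_analysis.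
From mathcomp Require Import measurable_realfun ring lra.
Set Implicit Arguments. Unset Strict Implicit. Unset Printing Implicit Defensive.
Import Order.TTheory GRing.Theory Num.Theory.
Import numFieldNormedType.Exports.
Local Open Scope classical_set_scope.
Local Open Scope ring_scope.

(** * Horseshoes of transitive interval maps *)

Section IntervalDynamics.
Context {R : realType}.
Implicit Types (f : R -> R) (a b c d p x y : R).

Definition transitive_on f a b :=
  forall c d c' d', a <= c -> c < d -> d <= b -> a <= c' -> c' < d' -> d' <= b ->
    exists n x, c < x < d /\ c' < iter n f x < d'.

(** The strict gap [w1 < w2] later leaves room for a continuous function that separates the two
    branches. *)
Definition horseshoe f (k : nat) a d := exists w1 w2,
  [/\ a <= w1, w1 < w2, w2 <= d &
    forall y, a <= y <= d ->
      (exists2 x, a <= x <= w1 & iter k f x = y) /\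
      (exists2 x, w2 <= x <= d & iter k f x = y)].

Lemma ivt_cover f a b y : continuous f -> a <= b ->
  f a <= y <= f b \/ f b <= y <= f a -> exists2 x, a <= x <= b & f x = y.
Proof.
move=> cf ab fab.
have [] := @IVT R f a b y ab (continuous_subspaceT cf).
  rewrite ge_min le_max.
  by case: fab => /andP[-> ->]; rewrite ?orbT.
by move=> x; rewrite in_itv/= => xab <-; exists x.
Qed.

Lemma iter_continuous f n : continuous f -> continuous (iter n f).
Proof.
by move=> cf; elim: n => [|n IH] x /=; [exact: cvg_id|apply: continuous_comp; [exact: IH|exact: cf]].
Qed.

Lemma iter_invariant f a b n x : (forall x, a <= x <= b -> a <= f x <= b) ->
  a <= x <= b -> a <= iter n f x <= b.
Proof. by move=> fab xab; elim: n => //= n; exact: fab. Qed.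

Lemma iter_fixed f n p : f p = p -> iter n f p = p.
Proof. by move=> fp; elim: n => //= n ->. Qed.

(* A homoclinic point [y] of a fixed point [p]: transitivity pushes some point
   between [y] and [p] beyond [y], while the same iterate sends both [y] and
   [p] to [p]. *)
Lemma homoclinic_horseshoe f a b p y : continuous f -> transitive_on f a b ->
  a <= p <= b -> f p = p -> a < y < b -> y != p -> f y = p ->
  exists k l r, [/\ (0 < k)%N, a <= l, r <= b & horseshoe f k l r].
Proof.
move=> cf tf /andP[ap pb] fp /andP[ay yb] yp fy.
have iterSy n : iter n.+1 f y = p by rewrite iterSr fy iter_fixed.
have [yltp|plty] : y < p \/ p < y by apply/orP; rewrite -neq_lt.
- have [n [x [/andP[yx xp] /andP[_ nxy]]]] := tf y p a y (ltW ay) yltp pb (lexx _) ay (ltW yb).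
  case: n nxy => [|n] nxy; first by move: nxy => /=; lra.
  exists n.+1, y, p; split=> //; first exact: ltW.
  (* The iterate equals [p] at both [y] and [p] and is below [y] at [x], so it crosses [y] on either
     side of [x]; the branches are [[y, u]] and [[v, p]]. *)
  have [u /andP[yu ux] fu] : exists2 u, y <= u <= x & iter n.+1 f u = y.
    apply: ivt_cover; [exact: iter_continuous|exact: ltW|].
    by right; rewrite iterSy; apply/andP; split; apply: ltW.
  have [v /andP[xv vp] fv] : exists2 v, x <= v <= p & iter n.+1 f v = y.
    apply: ivt_cover; [exact: iter_continuous|exact: ltW|].
    by left; rewrite (iter_fixed _ fp); apply/andP; split; apply: ltW.
  have ux' : u != x by apply: contraTneq nxy => <-; rewrite fu ltxx.
  exists u, v; split => //; first by rewrite (lt_le_trans _ xv)// lt_neqAle ux' ux.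
  move=> z zyp; split; apply: ivt_cover => //; try exact: iter_continuous.
    by right; rewrite iterSy fu.
  by left; rewrite (iter_fixed _ fp) fv.
- have [n [x [/andP[px xy] /andP[nxy _]]]] := tf p y y b ap plty (ltW yb) (ltW ay) yb (lexx _).
  case: n nxy => [|n] nxy; first by move: nxy => /=; lra.
  exists n.+1, p, y; split=> //; first exact: ltW.
  have [u /andP[pu ux] fu] : exists2 u, p <= u <= x & iter n.+1 f u = y.
    apply: ivt_cover; [exact: iter_continuous|exact: ltW|].
    by left; rewrite (iter_fixed _ fp); apply/andP; split; apply: ltW.
  have [v /andP[xv vy] fv] : exists2 v, x <= v <= y & iter n.+1 f v = y.
    apply: ivt_cover; [exact: iter_continuous|exact: ltW|].
    by right; rewrite iterSy; apply/andP; split; apply: ltW.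
  have ux' : u != x by apply: contraTneq nxy => <-; rewrite fu ltxx.
  exists u, v; split => //; first by rewrite (lt_le_trans _ xv)// lt_neqAle ux' ux.
  move=> z zyp; split; apply: ivt_cover => //; try exact: iter_continuous.
    by left; rewrite (iter_fixed _ fp) fu.
  by right; rewrite iterSy fv.
Qed.

(** Without one, [f x - x] keeps its sign inside, so one of the two halves cut at the midpoint is
    invariant, against transitivity. *)
Lemma interior_fixed f a b : a < b -> continuous f ->
  (forall x, a <= x <= b -> a <= f x <= b) -> transitive_on f a b ->
  exists2 p, a < p < b & f p = p.
Proof.
move=> ab cf fab tf; apply: contrapT => nofix.
have {}nofix p : a < p < b -> f p != p.
  by move=> pab; apply/eqP => fp; apply: nofix; exists p.
have cg : continuous (fun x => f x - x) by move=> x; apply: cvgB; [exact: cf|exact: cvg_id].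
pose c := (a + b) / 2.
have /andP[ac cb] : a < c < b by rewrite /c; lra.
have [fc|fc] : f c < c \/ c < f c by apply/orP; rewrite -neq_lt nofix // ac cb.
- have dec x : a <= x <= c -> f x <= x.
    move=> /andP[ax xc]; rewrite leNgt; apply/negP => xfx.
    have [z /andP[xz zc] /eqP] : exists2 z, x <= z <= c & f z - z = 0.
      by apply: ivt_cover => //; right; lra.
    rewrite subr_eq0 => /eqP fz.
    have zx : z != x by apply: contraTneq xfx => <-; rewrite fz ltxx.
    have xz' : x < z by rewrite lt_neqAle eq_sym zx.
    have /nofix : a < z < b by lra.
    by rewrite fz eqxx.
  have [n [x [/andP[ax xc] /andP[nx _]]]] := tf a c c b (lexx _) ac (ltW cb) (ltW ac) cb (lexx _).
  have : a <= iter n f x <= c.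
    elim: n {nx} => [|n IH] /=; first by apply/andP; split; apply: ltW.
    have := dec _ IH; have : a <= f (iter n f x) <= b by apply: fab; lra.
    by lra.
  by lra.
- have inc x : c <= x <= b -> x <= f x.
    move=> /andP[cx xb]; rewrite leNgt; apply/negP => xfx.
    have [z /andP[xz zc] /eqP] : exists2 z, c <= z <= x & f z - z = 0.
      by apply: ivt_cover => //; right; lra.
    rewrite subr_eq0 => /eqP fz.
    have zx : z != x by apply: contraTneq xfx => <-; rewrite fz ltxx.
    have xz' : z < x by rewrite lt_neqAle zx.
    have /nofix : a < z < b by lra.
    by rewrite fz eqxx.
  have [n [x [/andP[ax xc] /andP[_ nx]]]] := tf c b a c (ltW ac) cb (lexx _) (lexx _) ac (ltW cb).
  have : c <= iter n f x <= b.
    elim: n {nx} => [|n IH] /=; first by apply/andP; split; apply: ltW.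
    have := inc _ IH; have : a <= f (iter n f x) <= b by apply: fab; lra.
    by lra.
  by lra.
Qed.

(** If one point of [[a, p]] is sent below [p], then none is sent above, since [p] would have a
    preimage strictly between the two. So [[a, p]] is invariant, against transitivity; the other
    side is symmetric. *)
Lemma swap_sides f a b p : continuous f ->
  (forall x, a <= x <= b -> a <= f x <= b) -> transitive_on f a b ->
  a < p < b -> (forall y, a < y < b -> y != p -> f y != p) ->
  (forall x, a <= x <= p -> p <= f x) /\ (forall x, p <= x <= b -> f x <= p).
Proof.
move=> cf fab tf /andP[ap pb] nopre; split=> x.
- move=> /andP[ax xp]; rewrite leNgt; apply/negP => fxp.
  have inv y : a <= y <= p -> a <= f y <= p.
    move=> /andP[ay yp].
    have /andP[-> _] /= : a <= f y <= b by apply: fab; lra.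
    rewrite leNgt; apply/negP => pfy.
    have [z zxy fz] : exists2 z, Num.min x y <= z <= Num.max x y & f z = p.
      have [xy|yx] := leP x y; apply: ivt_cover => //; lra.
    have zx : z != x by apply: contraTneq fxp => <-; rewrite fz ltxx.
    have zy : z != y by apply: contraTneq pfy => <-; rewrite fz ltxx.
    have zp : a < z < p.
      move: zx zy zxy; rewrite !neq_lt; have [xy|yx] := leP x y; lra.
    have /nopre : a < z < b by lra.
    by rewrite fz eqxx lt_eqF; [move=> /(_ isT)|lra].
  have [n [z [/andP[az zp] /andP[nz _]]]] := tf a p p b (lexx _) ap (ltW pb) (ltW ap) pb (lexx _).
  have : a <= iter n f z <= p by apply: iter_invariant => //; lra.
  by lra.
- move=> /andP[px xb]; rewrite leNgt; apply/negP => pfx.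
  have inv y : p <= y <= b -> p <= f y <= b.
    move=> /andP[py yb].
    have /andP[_ ->] /= : a <= f y <= b by apply: fab; lra.
    rewrite andbT leNgt; apply/negP => fyp.
    have [z zxy fz] : exists2 z, Num.min x y <= z <= Num.max x y & f z = p.
      have [xy|yx] := leP x y; apply: ivt_cover => //; lra.
    have zx : z != x by apply: contraTneq pfx => <-; rewrite fz ltxx.
    have zy : z != y by apply: contraTneq fyp => <-; rewrite fz ltxx.
    have zp : p < z < b.
      move: zx zy zxy; rewrite !neq_lt; have [xy|yx] := leP x y; lra.
    have /nopre : a < z < b by lra.
    by rewrite fz eqxx gt_eqF; [move=> /(_ isT)|lra].
  have [n [z [/andP[az zp] /andP[_ nz]]]] := tf p b a p (ltW ap) pb (lexx _) (lexx _) ap (ltW pb).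
  have : p <= iter n f z <= b by apply: iter_invariant => //; lra.
  by lra.
Qed.

Lemma iter_comp2 f n x : iter n (f \o f) x = iter n.*2 f x.
Proof. by elim: n => //= n ->. Qed.

Lemma transitive_horseshoe f a b : a < b -> continuous f ->
  (forall x, a <= x <= b -> a <= f x <= b) -> transitive_on f a b ->
  exists k l r, [/\ (0 < k)%N, a <= l, r <= b & horseshoe f k l r].
Proof.
move=> ab cf fab tf; have [p pab fp] := interior_fixed ab cf fab tf.
have /andP[ap pb] := pab.
have [[y [yab yp fy]]|nopre] := pselect (exists y, [/\ a < y < b, y != p & f y = p]).
  by apply: (homoclinic_horseshoe cf tf _ fp yab yp fy); lra.
have [|swl swr] := swap_sides cf fab tf pab.
  by move=> y yab yp; apply/eqP => fy; apply: nopre; exists y.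
pose g := f \o f.
have cg : continuous g by move=> x; apply: continuous_comp; exact: cf.
have gap x : a <= x <= p -> a <= g x <= p.
  move=> xap; have h1 : a <= f x <= b by apply: fab; lra.
  have h2 := swl _ xap; have h3 := fab _ h1.
  by rewrite /g/= swr; lra.
have tg : transitive_on g a p.
  move=> c d c' d' ac cd dp ac' cd' dp'.
  have [n [x [xcd nx]]] := tf c d c' d' ac cd ltac:(lra) ac' cd' ltac:(lra).
  exists n./2, x; split => //; rewrite iter_comp2.
  have [nodd|neven] := boolP (odd n); last by rewrite even_halfK.
  (* Odd iterates send [[a, p]] to the right of [p], so they cannot enter []c', d'[]. *)
  have : p <= iter n f x.
    rewrite -(odd_double_half n) nodd add1n /= swl // -iter_comp2.
    by apply: iter_invariant => //; lra.
  by lra.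
have [q qap gq] := interior_fixed ap cg gap tg.
have [[y [yab yp fy]]|nopre'] := pselect (exists y, [/\ a < y < p, y != q & g y = q]).
  have qap' : a <= q <= p by lra.
  have [k [l [r [k0 al rp [w1 [w2 [lw ww wr H]]]]]]] :=
    homoclinic_horseshoe cg tg qap' gq yab yp fy.
  exists k.*2, l, r; split => //; [by rewrite double_gt0|lra|].
  exists w1, w2; split => // z /H[[u uw fu] [v vw fv]].
  by split; [exists u|exists v]; rewrite // -iter_comp2.
(* Swapping would send [p], now an endpoint, to [q] or below, yet [g p = p]. *)
have [|_ /(_ p)] := swap_sides cg gap tg qap.
  by move=> y yab yp; apply/eqP => fy; apply: nopre'; exists y.
by rewrite /g/= !fp; lra.
Qed.

End IntervalDynamics.

(** * Bounds on cover numbers *)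

Section Covers.
Context {R : realType}.

(** Members chosen around the points are pairwise distinct, by the separation hypothesis. *)
Lemma coverN_ge (X : Type) (C : set (set X)) (S : set X) (F : finType) (m : F -> X) :
  (forall w, S (m w)) ->
  (forall V w w', C V -> V (m w) -> V (m w') -> w = w') ->
  ((#|F|%:R)%:E <= coverN R C S)%E.
Proof.
move=> Sm sepm; apply: le_ereal_inf_tmp => _ [k [s [<- [sC sS]]] <-].
rewrite lee_fin ler_nat.
have /choice [V HV] : forall w, exists V, V \in s /\ V (m w).
  by move=> w; have [V /= Vs Vw] := sS _ (Sm w); exists V.
have Vinj : injective V.
  move=> w w' VV; apply: (sepm (V w)); [exact/sC/(HV w).1|exact: (HV w).2|].
  by rewrite VV; exact: (HV w').2.
rewrite cardE -(size_map V); apply: uniq_leq_size.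
  by rewrite map_inj_uniq ?enum_uniq.
by move=> _ /mapP[w _ ->]; exact: (HV w).1.
Qed.

Lemma coverN_le_size (X : Type) (C : set (set X)) (S : set X) (s : seq (set X)) :
  (forall V, V \in s -> C V) -> S `<=` \bigcup_(V in [set V | V \in s]) V ->
  (coverN R C S <= (size s)%:R%:E)%E.
Proof.
move=> sC sS; apply: ge_ereal_inf; exists (size s)%:R%:E => //.
by exists (size s) => //; exists s.
Qed.

(** Finiteness matters because [fine] sends [+oo] to [0]. The subcover has one set [V w] for each
    choice [w] of members of [A] at the [n] times. *)
Lemma coverN_join_lty (X : Type) (A : set (set X)) (S : set X)
    (phi : nat -> X -> X) (a : nat -> nat) (n : nat) : finite_set A ->
  (forall x i, S x -> exists2 U, A U & U (comp_seq phi (a i) x)) ->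
  (coverN R (join_pre A phi a n) S < +oo)%E.
Proof.
move=> /finite_seqP[s ->] covA.
pose V (w : {ffun 'I_n -> 'I_(size s)}) : set X :=
  \bigcap_(i in `I_n) (comp_seq phi (a i) @^-1`
    (if insub i is Some o then nth set0 s (w o) else set0)).
suff le : (coverN R (join_pre [set` s] phi a n) S <= (size [seq V w | w in predT])%:R%:E)%E.
  exact: le_lt_trans le (ltry _).
apply: coverN_le_size.
  move=> _ /mapP[w _ ->].
  exists (fun i => if insub i is Some o then nth set0 s (w o) else set0).
  by split=> // i lin; case: insubP => [j _ _|]; [exact: mem_nth|rewrite lin].
move=> x Sx; have /choice [U HU] : forall i, exists U, U \in s /\ U (comp_seq phi (a i) x).
  by move=> i; have [U /= Us Ux] := covA x i Sx; exists U.
have lt (o : 'I_n) : (index (U o) s < size s)%N by rewrite index_mem; exact: (HU o).1.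
exists (V [ffun o => Ordinal (lt o)]); first by apply: map_f; rewrite mem_enum.
move=> i /= lin; case: insubP => [j _ ji|]; last by rewrite lin.
by rewrite ffunE /= nth_index -?ji; [exact: (HU _).2|exact: (HU _).1].
Qed.

(** Time [0] is left out because the entropy quotient vanishes there, [0^-1] being [0]. *)
Lemma limn_esup_ge (u : nat -> \bar R) (l : \bar R) :
  (forall n, (0 < n)%N -> (l <= u n)%E) -> (l <= limn_esup u)%E.
Proof.
move=> lu; apply: le_ereal_inf_tmp => _ [V [N _ NV] <-].
apply: le_trans (lu N.+1 isT) _; apply: ereal_sup_ubound; exists N.+1 => //.
exact: NV (leqnSn N).
Qed.

End Covers.

(** * Empirical measures and their push-forwards *)

Section EmpiricalMeasures.
Context {R : realType}.
Implicit Types (f g : R -> R) (x : nat -> R).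

Lemma measurable_I01 : measurable (@I01 R : set R).
Proof. exact: measurable_itv. Qed.

Definition dirac_meas x : nat -> {measure set R -> \bar R} :=
  fun l => \d_(x l) : {measure set R -> \bar R}.

Definition empirical (K : nat) x : set R -> \bar R :=
  mscale (K.+1%:R^-1)%:nng (msum (dirac_meas x) K.+1).

HB.instance Definition _ K x := Measure.on (empirical K x).

Lemma empiricalE K x B : empirical K x B = (K.+1%:R^-1 * \sum_(l < K.+1) \1_B (x l))%:E.
Proof. by rewrite /empirical/= /mscale/= /msum/= EFinM -sumEFin. Qed.

Lemma empiricalT K x : empirical K x setT = 1%E.
Proof.
rewrite empiricalE; under eq_bigr do rewrite indicT.
by rewrite sumr_const card_ord mulVf.
Qed.

HB.instance Definition _ K x :=
  Measure_isProbability.Build _ _ _ (empirical K x) (empiricalT K x).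

Lemma empirical_MI K x : (forall l, I01 (x l)) -> MI (empirical K x : set R -> \bar R).
Proof.
move=> xI; exists (empirical K x : probability R R); split => //.
rewrite /measI/= empiricalE big1 ?mulr0// => l _.
by rewrite indicE memNset//= => /(_ (xI l)).
Qed.

Lemma hat_empirical f K x : (forall l, I01 (x l)) ->
  hat f (empirical K x) = empirical K (f \o x).
Proof.
move=> xI; apply/funext => B; rewrite /hat !empiricalE; congr (_ * _)%:E.
apply: eq_bigr => l _; rewrite !indicE; congr (_%:R); congr nat_of_bool.
by apply/idP/idP; rewrite !inE; [by case|by split].
Qed.

Lemma comp_seq_hat_empirical f K x n : (forall y, I01 y -> I01 (f y)) ->
  (forall l, I01 (x l)) ->
  comp_seq (fun=> hat f) n (empirical K x) = empirical K (fun l => iter n f (x l)).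
Proof.
move=> fI xI; elim: n => [|n IH] //=.
rewrite IH hat_empirical// => l.
by elim: n {IH} => //= n; exact: fI.
Qed.

Lemma integral_empirical g K x : continuous g -> (forall y, 0 <= g y) ->
  (forall l, I01 (x l)) ->
  (\int[empirical K x]_(y in @I01 R) (g y)%:E)%E =
    (K.+1%:R^-1 * \sum_(l < K.+1) g (x l))%:E.
Proof.
move=> cg g0 xI.
have mg : measurable_fun (@I01 R) (EFin \o g).
  apply/measurable_EFinP.
  exact: measurable_funS (continuous_measurable_fun cg).
rewrite ge0_integral_mscale//=; [|exact: measurable_I01|by move=> y _; rewrite lee_fin].
rewrite ge0_integral_measure_sum//=; [|exact: measurable_I01|by move=> y _; rewrite lee_fin].
rewrite EFinM -sumEFin; congr (_ * _)%E; apply: eq_bigr => l _.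
rewrite integral_dirac//; last exact: measurable_I01.
by rewrite diracE mem_set// mul1e.
Qed.

End EmpiricalMeasures.

(** * Orbits with prescribed itineraries *)

Section Itineraries.
Context {R : realType}.
Implicit Types (f g : R -> R) (x y : R).

Lemma I01E x : I01 x = (0 <= x <= 1) :> Prop.
Proof. by rewrite /I01/= in_itv. Qed.

(** The retraction onto [[0, 1]]: composing with it turns continuity within [I01] into continuity on
    the whole line, as the interval lemmas require. *)
Definition clamp01 x : R := Num.min 1 (Num.max 0 x).

Lemma clamp01_itv x : 0 <= clamp01 x <= 1.
Proof.
rewrite /clamp01; have [?|?] := leP 0 x.
  by have [?|?] := leP 1 x; lra.
by have [?|?] := leP 1 (0 : R); lra.
Qed.

Lemma clamp01_id x : 0 <= x <= 1 -> clamp01 x = x.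
Proof. by move=> /andP[x0 x1]; rewrite /clamp01 max_r// min_r. Qed.

Lemma continuous_clamp01 : continuous clamp01.
Proof.
move=> x; apply: continuous_min; first exact: cvg_cst.
by apply: continuous_max; [exact: cvg_cst|exact: cvg_id].
Qed.

Lemma continuous_comp_clamp01 f : {within @I01 R, continuous f} -> continuous (f \o clamp01).
Proof.
move=> /subspace_continuousP cf x.
have Ix : I01 (clamp01 x) by rewrite I01E clamp01_itv.
apply: (@cvg_comp _ _ _ clamp01 f _ _ _ _ (cf _ Ix)) => V.
move=> /= /continuous_clamp01 nV.
change (nbhs x [set y | V (clamp01 y)]).
apply: (@filterS _ (nbhs x) _ _ _ _ nV) => y /=; apply.
by rewrite I01E clamp01_itv.
Qed.

Lemma comp_seq_iter f n : comp_seq (fun=> f) n = iter n f.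
Proof. by elim: n => //= n ->; apply/funext. Qed.

Lemma selfmapI_horseshoe f : selfmapI f -> top_transitive (fun=> f) ->
  exists k l r, [/\ (0 < k)%N, 0 <= l, r <= 1 & horseshoe f k l r].
Proof.
move=> [cf fI] tf; pose F := f \o clamp01.
have F01 x : 0 <= x <= 1 -> 0 <= F x <= 1.
  move=> x01; have := fI x; rewrite /F/= clamp01_id// !I01E; exact.
have iterF n x : 0 <= x <= 1 -> iter n F x = iter n f x.
  move=> x01; elim: n => //= n <-.
  by rewrite {1}/F /= clamp01_id//; exact: iter_invariant.
have tF : transitive_on F 0 1.
  move=> c d c' d' c0 cd d1 c'0 cd' d'1.
  have ne a b : 0 <= a -> a < b -> b <= 1 -> ([set` `]a, b[] `&` @I01 R) !=set0.
    by move=> a0 ab b1; exists ((a + b) / 2); split; rewrite ?I01E/= ?in_itv/=; lra.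
  have [n [n1 [x [[xcd xI] [nx _]]]]] :=
    tf _ _ (itv_open c d) (itv_open c' d') (ne _ _ c0 cd d1) (ne _ _ c'0 cd' d'1).
  exists n, x; move: xcd xI nx; rewrite comp_seq_iter I01E/= !in_itv/= => xcd xI nx.
  by rewrite iterF.
have [k [l [r [k0 l0 r1 [w1 [w2 [lw ww wr H]]]]]]] :=
  transitive_horseshoe ltr01 (continuous_comp_clamp01 cf) F01 tF.
exists k, l, r; split => //; exists w1, w2; split => // y /H[[u uw fu] [v vw fv]].
split; [exists u|exists v] => //.
  by rewrite -iterF//; lra.
by rewrite -iterF//; lra.
Qed.

(** Induction on the length: realise the shifted itinerary by [y], then take the preimage of [y] in
    the branch that [s 0] names. *)
Lemma horseshoe_itinerary f k l r w1 w2 : l <= w1 -> w1 < w2 -> w2 <= r ->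
  (forall y, l <= y <= r ->
      (exists2 x, l <= x <= w1 & iter k f x = y) /\
      (exists2 x, w2 <= x <= r & iter k f x = y)) ->
  forall n (s : nat -> bool), exists2 x, l <= x <= r &
    forall t, (t < n)%N -> if s t then iter (k * t) f x <= w1 else w2 <= iter (k * t) f x.
Proof.
move=> lw ww wr H; elim=> [|n IH] s.
  by exists l => //; lra.
have [y ylr ys] := IH (s \o succn).
have step z : iter k f z = y -> forall t, iter (k * t.+1) f z = iter (k * t) f y.
  by move=> <- t; rewrite mulnS addnC iterD.
have [[u uw fu] [v vw fv]] := H y ylr.
exists (if s 0%N then u else v); first by case: ifP => _; lra.
case=> [|t] tn; last first.
  by have := ys t tn; rewrite /=; case: (s 0%N) => /=; rewrite ?(step u fu) ?(step v fv).
by rewrite muln0 /=; case: (s 0%N) => /=; lra.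
Qed.

(* Sampling at the times congruent to [q] modulo [k]: pushing the itinerary
   point forward by [k - q] steps synchronises these times with [iter k f]. *)
Lemma shifted_itinerary f k l r w1 w2 : (forall x, I01 x -> I01 (f x)) ->
  0 <= l -> r <= 1 -> l <= w1 -> w1 < w2 -> w2 <= r ->
  (forall y, l <= y <= r ->
      (exists2 x, l <= x <= w1 & iter k f x = y) /\
      (exists2 x, w2 <= x <= r & iter k f x = y)) ->
  forall q n (s : nat -> bool), (q < k)%N -> exists2 x, I01 x &
    forall t, (t < n)%N -> if s t then iter (q + k * t) f x <= w1
                           else w2 <= iter (q + k * t) f x.
Proof.
move=> fI l0 r1 lw ww wr H q n s qk.
(* The push-forward uses up the entry at time 0; hence one more entry and the shift by [predn]. *)
have [y ylr ys] := horseshoe_itinerary lw ww wr H n.+1 (s \o predn).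
exists (iter (k - q) f y).
  have : I01 y by rewrite I01E; lra.
  by elim: (k - q)%N => //= m IH yI; exact/fI/IH.
move=> t tn; have := ys t.+1 tn.
by rewrite -iterD addnAC subnKC ?(ltnW qk)// -mulnS.
Qed.

End Itineraries.

(** * Infinite entropy from a horseshoe *)

Section EntropyLowerBound.
Context {R : realType}.
Implicit Types (f g : R -> R) (x y : R).

Lemma residue_pigeonhole (a : nat -> nat) (k n : nat) : (0 < k)%N ->
  exists2 q, (q < k)%N & (n <= k * #|{: {i : 'I_n | (a i %% k)%N == q}}|)%N.
Proof.
case: k => // k _; pose c (q : 'I_k.+1) := #|{: {i : 'I_n | (a i %% k.+1)%N == q}}|.
exists [arg max_(q > ord0) c q] => //.
case: arg_maxnP => // q _ qmax.
have nE : n = (\sum_(p < k.+1) c p)%N.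
  rewrite -[LHS]card_ord -sum1_card.
  rewrite (partition_big (fun i : 'I_n => inord (a i %% k.+1)%N : 'I_k.+1) predT)//=.
  apply: eq_bigr => p _; rewrite /c card_sig -sum1_card; apply: eq_bigl => i.
  by rewrite inE -val_eqE /= inordK// ltn_mod.
rewrite [X in (X <= _)%N]nE -[X in (_ <= X * _)%N]card_ord -sum_nat_const.
by apply: leq_sum => p _; exact: qmax.
Qed.

(** Equal to 1 on the left branch and 0 on the right one, so that its integral against an empirical
    measure carried by the branches is the mass of the left branch. *)
Definition ramp (w1 w2 x : R) : R := Num.min 1 (Num.max 0 ((w2 - x) / (w2 - w1))).

Lemma continuous_ramp w1 w2 : continuous (ramp w1 w2).
Proof.
move=> x; apply: (@continuous_comp _ _ _ (fun x : R => (w2 - x) / (w2 - w1)) clamp01);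
  last exact: continuous_clamp01.
by apply: cvgM; [apply: cvgB; [exact: cvg_cst|exact: cvg_id]|exact: cvg_cst].
Qed.

Lemma ramp_ge0 w1 w2 x : 0 <= ramp w1 w2 x.
Proof. by case/andP: (clamp01_itv ((w2 - x) / (w2 - w1))). Qed.

Lemma ramp_left w1 w2 x : w1 < w2 -> x <= w1 -> ramp w1 w2 x = 1.
Proof.
move=> ww xw; have : 1 <= (w2 - x) / (w2 - w1) by rewrite ler_pdivlMr; lra.
by move=> h; rewrite /ramp max_r ?min_l//; lra.
Qed.

Lemma ramp_right w1 w2 x : w1 < w2 -> w2 <= x -> ramp w1 w2 x = 0.
Proof.
move=> ww xw; have : (w2 - x) / (w2 - w1) <= 0.
  by rewrite ler_pdivrMr ?mul0r; lra.
by move=> h; rewrite /ramp max_l// min_r//; lra.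
Qed.

(** This is [Rintegral] over [I01] for bare set functions, the points on which [hat] acts. *)
Definition Iint g (m : set R -> \bar R) : R := fine (\int[m]_(y in @I01 R) (g y)%:E)%E.

(** A measure whose integral is [v i] can lie in no member but that of index [i], so the cover
    separates measures with distinct integrals among the [v i]. *)
Definition avoid g (v : nat -> R) (J : nat) (j : 'I_J) : set (set R -> \bar R) :=
  [set m | forall i : 'I_J, i != j -> Iint g m != v i].

Lemma wopen_avoid g (v : nat -> R) J (j : 'I_J) : continuous g -> Defs.wopen (avoid g v j).
Proof.
move=> cg P _ Pj.
(* The radius is the least distance to a forbidden value; the cap [1] covers the case where there is
   none. *)
exists 1%N, (fun=> g), (\big[Num.min/1]_(i < J | i != j) `|Iint g P - v i|).
split.
  by apply: lt_bigmin => // i ij; rewrite normr_gt0 subr_eq0; exact: Pj.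
split; first by move=> _; exact: continuous_subspaceT.
move=> Q _ /(_ ord0) QP i ij; apply: contraTneq QP => Qi.
rewrite -leNgt; have -> : Rintegral Q (@I01 R) g = v i by [].
by rewrite distrC; exact: bigmin_le_cond.
Qed.

Lemma avoid_open_cover g (v : nat -> R) J : continuous g -> injective (fun j : 'I_J.+1 => v j) ->
  open_coverMI [set avoid g v j | j in [set: 'I_J.+1]] /\
  forall m, exists j : 'I_J.+1, avoid g v j m.
Proof.
move=> cg vinj; have cov m : exists j : 'I_J.+1, avoid g v j m.
  have [[j mj]|nj] := pselect (exists j : 'I_J.+1, Iint g m = v j).
    by exists j => i; apply: contraNneq; rewrite mj => /vinj ->.
  by exists ord0 => i _; apply/eqP => mi; apply: nj; exists i.
split => //; split; first exact/finite_image/finite_finset.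
split; first by move=> _ [j _ <-]; exact: wopen_avoid.
by move=> m _; have [j mj] := cov m; exists (avoid g v j) => //; exists j.
Qed.

(** At the sampled time of index [i], the atom [l] is left of [w1] if [l < w i] and right of [w2]
    otherwise, so [w i] of the [K.+1] atoms count. *)
Lemma empirical_itinerary f (w1 w2 : R) (K q k n : nat) (a : nat -> nat)
    (w : {ffun {i : 'I_n | (a i %% k)%N == q} -> 'I_K.+2}) :
  strict_incr a -> (forall x, I01 x -> I01 (f x)) -> w1 < w2 ->
  (forall N (s : nat -> bool), exists2 x, I01 x &
    forall t, (t < N)%N -> if s t then iter (q + k * t) f x <= w1
                           else w2 <= iter (q + k * t) f x) ->
  exists x : nat -> R, (forall l, I01 (x l)) /\
    forall i : {i : 'I_n | (a i %% k)%N == q},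
    Iint (ramp w1 w2) (comp_seq (fun=> hat f) (a (val i)) (empirical K x)) =
      K.+1%:R^-1 * (w i)%:R.
Proof.
move=> ainc fI ww itin.
have amono i j : (i < j)%N -> (a i < a j)%N.
  exact: (@homo_ltn _ a (fun m p => (m < p)%N) (fun _ _ _ => @ltn_trans _ _ _) ainc).
have ainj : injective a.
  by move=> i j aij; case: (ltngtP i j) => // /amono; rewrite aij ltnn.
(* Within one residue class the quotient by [k] determines the time, and [a] is injective, so at
   most one index matches [t]; the default [0] is arbitrary. *)
pose c t := if [pick i : {i : 'I_n | (a i %% k)%N == q} | (a (val i) %/ k)%N == t] is Some i
  then (w i : nat) else 0%N.
have cE (i : {i : 'I_n | (a i %% k)%N == q}) : c (a (val i) %/ k)%N = w i.
  rewrite /c; case: pickP => [j /eqP ji|/(_ i)]; last by rewrite eqxx.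
  congr (nat_of_ord (w _)); apply/val_inj/val_inj/ainj.
  by rewrite (divn_eq (a (val j)) k) (divn_eq (a (val i)) k) ji (eqP (valP i)) (eqP (valP j)).
have /choice[x xP] : forall l : nat, exists x, I01 x /\
    forall t, (t < (a n).+1)%N -> if (l < c t)%N then iter (q + k * t) f x <= w1
                           else w2 <= iter (q + k * t) f x.
  by move=> l; have [x Ix Hx] := itin (a n).+1 (fun t => (l < c t)%N); exists x.
have xI l : I01 (x l) by exact: (xP l).1.
exists x; split => // i; rewrite comp_seq_hat_empirical//.
have fxI l : I01 (iter (a (val i)) f (x l)).
  by elim: (a _) => //= m; exact: fI.
rewrite /Iint integral_empirical//=; [|exact: continuous_ramp|exact: ramp_ge0].
congr (_ * _).
have wi : (w i <= K.+1)%N by rewrite -ltnS.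
rewrite -[in RHS](card_ord (w i)) -sum1_card natr_sum.
rewrite (big_ord_widen _ (fun=> 1%:R) wi) [RHS]big_mkcond/=.
apply: eq_bigr => l _.
have lt : ((a (val i) %/ k)%N < (a n).+1)%N.
  by rewrite ltnS (leq_trans (leq_div _ _))// ltnW// amono.
have := (xP l).2 _ lt; rewrite cE mulnC addnC -[X in (_ + X)%N](eqP (valP i)) -divn_eq.
by case: ifP => _ h; [rewrite ramp_left|rewrite ramp_right].
Qed.

(** With [K.+1] atoms the left mass takes [K.+2] values, prescribed freely at the [M] times of the
    best residue class. This gives [K.+2 ^ M] measures, no two in one member of the join, and
    [n <= k * M]. *)
Lemma seq_entropy_ge f (k K : nat) (l r : R) (a : nat -> nat) :
  (forall x, I01 x -> I01 (f x)) -> strict_incr a -> (0 < k)%N -> 0 <= l -> r <= 1 ->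
  horseshoe f k l r ->
  ((k%:R^-1 * ln K.+2%:R)%:E <= seq_entropy a (fun=> hat f))%E.
Proof.
move=> fI ainc k0 l0 r1 [w1 [w2 [lw ww wr H]]].
pose v (i : nat) : R := K.+1%:R^-1 * i%:R.
have vinj : injective (fun j : 'I_K.+2 => v j).
  have K0 : K.+1%:R^-1 != 0 :> R by rewrite invr_eq0 pnatr_eq0.
  by move=> i j /(mulfI K0)/eqP; rewrite eqr_nat => /eqP/val_inj.
have [Aopen Acov] := avoid_open_cover (@continuous_ramp w1 w2) vinj.
set A := (X in open_coverMI X) in Aopen.
apply: le_trans (ereal_sup_ubound _); last by exists A.
apply: limn_esup_ge => n n0; rewrite lee_fin.
have [q qk nq] := residue_pigeonhole a n k0.
have itin := shifted_itinerary fI l0 r1 lw ww wr H (q := q) _ _ qk.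
have /choice[x xP] := fun w => empirical_itinerary (K := K) (n := n) (a := a) w ainc fI ww itin.
set M := #|{: {i : 'I_n | (a i %% k)%N == q}}| in nq.
have ge : ((K.+2 ^ M)%:R%:E <= coverN R (join_pre A (fun=> hat f) a n) (@MI R))%E.
  rewrite -[X in (X ^ _)%N]card_ord -card_ffun.
  apply: (@coverN_ge _ _ _ _ _ (fun w => empirical K (x w) : set R -> \bar R)).
    by move=> w; apply: empirical_MI; exact: (xP w).1.
  move=> _ w w' [U [UA ->]] Vw Vw'; apply/ffunP => i.
  have [j _ Uj] := UA (val i) (ltn_ord (val i)).
  have E u : (\bigcap_(i0 in `I_n) (comp_seq (fun=> hat f) (a i0) @^-1` U i0))
      (empirical K (x u)) -> u i = j.
    move=> /(_ (val i) (ltn_ord (val i))) /=; rewrite -Uj => /(_ (u i)).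
    rewrite (xP u).2 eqxx => h; apply/eqP; apply: contraT => /h //.
  by rewrite (E _ Vw) (E _ Vw').
have lty : (coverN R (join_pre A (fun=> hat f) a n) (@MI R) < +oo)%E.
  apply: coverN_join_lty; first exact: Aopen.1.
  move=> m i _; have [j mj] := Acov (comp_seq (fun=> hat f) (a i) m).
  by exists (avoid (ramp w1 w2) v j) => //; exists j.
have fge : (K.+2 ^ M)%:R <= fine (coverN R (join_pre A (fun=> hat f) a n) (@MI R)).
  rewrite -lee_fin fineK// fin_numElt lty andbT.
  by apply: lt_le_trans ge; rewrite ltNyr.
apply: le_trans (_ : n%:R^-1 * ln (K.+2 ^ M)%:R <= _); last first.
  rewrite ler_wpM2l ?invr_ge0// ler_ln ?posrE// ?ltr0n ?expn_gt0//.
  by apply: lt_le_trans fge; rewrite ltr0n expn_gt0.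
rewrite natrX lnXn ?ltr0n// -[ln _ *+ M]mulr_natl mulrA ler_wpM2r ?ln_ge0 ?ler1n//.
rewrite ler_pdivlMl ?ltr0n// mulrC ler_pdivrMl ?ltr0n//.
by rewrite -natrM ler_nat.
Qed.

Lemma transitive_seq_entropy f (a : nat -> nat) :
  selfmapI f -> top_transitive (fun=> f) -> strict_incr a ->
  seq_entropy a (fun=> hat f) = +oo%E.
Proof.
move=> sf tf ainc; have [k [l [r [k0 l0 r1 H]]]] := selfmapI_horseshoe sf tf.
(* As [k] is fixed, [K] can be taken with [ln K.+2] at least [k * x]. *)
apply: eq_infty => x; set K := Num.bound (expR (k%:R * x)).
apply: le_trans (seq_entropy_ge K sf.2 ainc k0 l0 r1 H).
rewrite lee_fin ler_pdivlMl ?ltr0n// -[leLHS]expRK ler_ln ?posrE ?expR_gt0 ?ltr0n//.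
apply: (le_trans (ltW (archi_boundP (expR_ge0 _)))).
by rewrite ler_nat -addn2 leq_addr.
Qed.

End EntropyLowerBound.

(** * A transitive sequence of Moebius maps *)

Section EntropyZero.
Context {R : realType}.
Implicit Types (f g : R -> R) (t x y : R).

(* In the odds coordinate [x / (1 - x)] this is multiplication by [t]. *)
Definition moebius t x : R := t * x / (1 + (t - 1) * x).

Lemma moebius_den_gt0 t x : 0 < t -> 0 <= x <= 1 -> 0 < 1 + (t - 1) * x.
Proof.
move=> t0 /andP[x0 x1]; have [->|xn1] := eqVneq x 1; first by lra.
have : 0 <= t * x by rewrite mulr_ge0// ltW.
by have : x < 1 by [rewrite lt_neqAle xn1]; lra.
Qed.

Lemma moebius_selfmap t : 0 < t -> selfmapI (moebius t).
Proof.
move=> t0; split; last first.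
  move=> x; rewrite !I01E => x01; have d0 := moebius_den_gt0 t0 x01.
  rewrite /moebius divr_ge0 ?(ltW d0) ?mulr_ge0 ?(ltW t0)//=; last by case/andP: x01.
  by rewrite ler_pdivrMr//; lra.
apply/subspace_continuousP => x; rewrite I01E => x01.
apply: cvg_within_filter; apply: cvgM.
  by apply: cvgM; [exact: cvg_cst|exact: cvg_id].
apply: cvgV; first by rewrite gt_eqF// moebius_den_gt0.
apply: cvgD; first exact: cvg_cst.
by apply: cvgM; [exact: cvg_cst|exact: cvg_id].
Qed.

Lemma moebiusK t x : 0 < t -> 0 <= x <= 1 -> moebius t^-1 (moebius t x) = x.
Proof.
move=> t0 x01; have d0 := moebius_den_gt0 t0 x01.
rewrite /moebius; field.
rewrite !gt_eqF//.
by have -> : 1 + (t - 1) * x + (1 + -1 * t) * x = 1 by ring.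
Qed.

(** An enumeration of the positive rationals, with the default 1 at numbers that code none. *)
Definition speed (n : nat) : R :=
  if (unpickle n : option rat) is Some q then if 0 < q then ratr q else 1 else 1.

Lemma speed_gt0 n : 0 < speed n.
Proof. by rewrite /speed; case: unpickle => // q; case: ifP; rewrite ?ltr0q. Qed.

Lemma speed_surj (q : rat) : 0 < q -> exists n, speed n = ratr q.
Proof. by move=> q0; exists (pickle q); rewrite /speed pickleK q0. Qed.

Definition there_and_back (n : nat) : R -> R :=
  if odd n then moebius (speed n./2)^-1 else moebius (speed n./2).

Lemma there_and_back_selfmap n : selfmapI (there_and_back n).
Proof.
by rewrite /there_and_back; case: ifP => _; apply: moebius_selfmap;
  rewrite ?invr_gt0 speed_gt0.
Qed.

Lemma there_and_back_even n x : I01 x -> comp_seq there_and_back n.*2 x = x.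
Proof.
move=> xI; elim: n => //= n ->.
by rewrite /there_and_back /= odd_double uphalf_double doubleK /= moebiusK ?speed_gt0// -I01E.
Qed.

Lemma open_rational_point (O : set R) : open O -> (O `&` @I01 R) !=set0 ->
  exists q : rat, 0 < q < 1 /\ O (ratr q).
Proof.
move=> oO [x [Ox]]; rewrite I01E => /andP[x0 x1].
have [r [r0 rO]] : exists r : R, 0 < r /\ `]x - r, x + r[ `<=` O.
  have := open_itvoo_subset oO Ox; rewrite near_withinE => -[e /= e0 eO].
  exists (e / 2); split; first by rewrite divr_gt0.
  apply: eO; last by rewrite divr_gt0.
  by rewrite /ball/= sub0r normrN gtr0_norm; lra.
(* The point [x] may be an endpoint, so the interval is cut down to []0, 1[], which it still
   meets. *)
have lt : Num.max 0 (x - r) < Num.min 1 (x + r).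
  by rewrite lt_min !gt_max; lra.
have [q] := rat_in_itvoo lt; rewrite in_itv/= gt_max lt_min => /andP[/andP[q0 xq] /andP[q1 qx]].
exists q; split; first by rewrite -(ltr0q R) q0 -(ltr_rat R) rmorph1.
by apply: rO; rewrite /= in_itv/= xq.
Qed.

Lemma there_and_back_transitive : top_transitive there_and_back.
Proof.
move=> O1 O2 o1 o2 ne1 ne2.
have [u [/andP[u0 u1] O1u]] := open_rational_point o1 ne1.
have [v [/andP[v0 v1] O2v]] := open_rational_point o2 ne2.
(* The quotient of the odds of [v] by those of [u]. *)
have q0 : 0 < (v * (1 - u)) / (u * (1 - v)).
  by rewrite divr_gt0 ?mulr_gt0// subr_gt0.
have [n nq] := speed_surj q0.
have I (w : rat) : 0 < w -> w < 1 -> I01 (ratr w : R).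
  by rewrite -(ltr0q R) -(ltr_rat R) rmorph1 => w0 w1; rewrite I01E !ltW.
exists n.*2.+1; split => //; exists (ratr u); split; first by split; [|exact: I].
rewrite /= there_and_back_even; last exact: I.
rewrite /there_and_back odd_double doubleK nq.
have -> : moebius (ratr (v * (1 - u) / (u * (1 - v)))) (ratr u) = ratr v :> R.
  rewrite /moebius.
  rewrite -[1]/(1%R) -(rmorph1 (@ratr R)) -rmorphB -!rmorphM -rmorphD -fmorph_div.
  congr ratr; field.
  by apply/andP; split; lra.
by split; [|exact: I].
Qed.

(** * Zero entropy along the even times *)

Lemma comp_seq_hat (fs : nat -> R -> R) n (m : set R -> \bar R) :
  (forall i, selfmapI (fs i)) ->
  comp_seq (fun i => hat (fs i)) n.+1 m =
    fun B => m (@I01 R `&` comp_seq fs n.+1 @^-1` B).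
Proof.
move=> sfs; elim: n m => [//|n IH] m.
change (hat (fs n.+1) (comp_seq (fun i => hat (fs i)) n.+1 m) =
  fun B => m (@I01 R `&` comp_seq fs n.+2 @^-1` B)); rewrite IH.
apply/funext => B; rewrite /hat; congr m; apply/seteqP; split => x [xI].
  by case=> _ Bx; split.
move=> Bx; split => //; split => //.
(* Orbits stay in [I01], so the intermediate intersection removes nothing. *)
have : forall k, I01 (comp_seq fs k x) by elim=> //= k; exact: (sfs k).2.
exact.
Qed.

(* The hypothesis on [P] is carried along so that the restriction has mass 1. *)
Definition restrict_I01 (P : probability R R) (PI : measI P) : set R -> \bar R :=
  mrestr P (@measurable_I01 R).

HB.instance Definition _ P PI := Measure.on (@restrict_I01 P PI).

Lemma restrict_I01_setT P PI : @restrict_I01 P PI setT = 1%E.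
Proof.
rewrite /restrict_I01 /mrestr setTI -[X in P X]setCK.
rewrite (probability_setC P (measurableC (@measurable_I01 R))).
by rewrite [X in (_ - X)%E]PI sube0.
Qed.

HB.instance Definition _ P PI :=
  Measure_isProbability.Build _ _ _ (@restrict_I01 P PI) (restrict_I01_setT PI).

(** Set functions are compared on all subsets, measurable or not, so the restriction is exhibited as
    a probability measure of its own. *)
Lemma MI_restrict (m : set R -> \bar R) : MI m -> MI (fun B => m (@I01 R `&` B)).
Proof.
move=> [P [PI ->]]; exists (restrict_I01 PI : probability R R); split.
  by rewrite /measI /= /restrict_I01 /mrestr setICl measure0.
by apply/funext => B; rewrite /= /restrict_I01 /mrestr setIC.
Qed.

Lemma MI_nonempty : exists m : set R -> \bar R, MI m.
Proof.
exists (empirical 0 (fun=> 0)); apply: empirical_MI => _.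
by rewrite I01E lexx ler01.
Qed.

(** A member of [A] around [Phi m] serves at all times at once, so the cover numbers stay below the
    size of [A] and their logarithms divided by [n] tend to 0. *)
Lemma seq_entropy_const (phi : nat -> (set R -> \bar R) -> set R -> \bar R)
    (a : nat -> nat) (Phi : (set R -> \bar R) -> set R -> \bar R) :
  (forall i m, comp_seq phi (a i) m = Phi m) -> (forall m, MI m -> MI (Phi m)) ->
  seq_entropy a phi = 0%E.
Proof.
move=> phiE PhiMI; have [m0 m0I] := MI_nonempty.
have val0 (A : set (set (set R -> \bar R))) : open_coverMI A ->
    limn_esup (fun n : nat =>
      ((n%:R)^-1 * ln (fine (coverN R (join_pre A phi a n) (@MI R))))%:E) = 0%E.
  move=> [/finite_seqP[s sA] [_ Acov]].
  pose c n := coverN R (join_pre A phi a n) (@MI R).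
  have c1 n : (1%:E <= c n)%E.
    rewrite -[1]/(1%:R) -card_unit; apply: (@coverN_ge _ _ _ _ unit (fun=> m0)) => //.
    by move=> V [] [].
  have cs n : (c n <= (size s)%:R%:E)%E.
    rewrite -(size_map (fun U => \bigcap_(i in `I_n) (comp_seq phi (a i) @^-1` U)) s).
    apply: coverN_le_size.
      by move=> _ /mapP[U Us ->]; exists (fun=> U); split => // i _; rewrite sA.
    move=> m mI; have [U AU Um] := Acov _ (PhiMI _ mI).
    exists (\bigcap_(i in `I_n) (comp_seq phi (a i) @^-1` U)).
      by apply/mapP; exists U => //; move: AU; rewrite sA.
    by move=> i _; rewrite /= phiE.
  have cfin n : c n \is a fin_num.
    rewrite fin_numElt (lt_le_trans _ (c1 n)) ?ltNyr//=.
    by rewrite (le_lt_trans (cs n)) ?ltry.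
  have fc1 n : 1 <= fine (c n) by rewrite -lee_fin fineK.
  have fcs n : fine (c n) <= (size s)%:R by rewrite -lee_fin fineK.
  suff cv : n%:R^-1 * ln (fine (c n)) @[n --> \oo] --> (0 : R).
    have cvE : (n%:R^-1 * ln (fine (c n)))%:E @[n --> \oo] --> (0 : R)%:E.
      by apply: cvg_EFin => //; near=> n.
    exact: (cvg_limn_einf_sup cvE).2.
  apply: (@squeeze_cvgr _ _ _ _ (fun=> 0) (fun n => n%:R^-1 * ln (size s)%:R)).
  - near=> n; rewrite mulr_ge0 ?invr_ge0 ?ln_ge0//=.
    rewrite ler_wpM2l ?invr_ge0// ler_ln// posrE ?(lt_le_trans ltr01)//.
    exact: le_trans (fc1 n) (fcs n).
  - exact: cvg_cst.
  - rewrite -[X in _ --> X](mul0r (ln (size s)%:R)); apply: cvgM; last exact: cvg_cst.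
    apply/gtr0_cvgV0; last exact: cvgr_idn.
    by near=> n; rewrite ltr0n; near: n; exact: nbhs_infty_gt.
apply/eqP; rewrite eq_le; apply/andP; split.
  by apply: ub_ereal_sup => _ [A /val0 -> <-].
(* The trivial cover keeps the supremum from being taken over the empty set. *)
have triv : open_coverMI [set (setT : set (set R -> \bar R))].
  split; first exact: finite_set1.
  split; last by move=> m _; exists setT.
  by move=> _ -> P _ _; exists 0%N, (fun=> id), 1; split => //; split => // -[].
by apply: ereal_sup_ubound; exists [set setT] => //; exact: val0.
Unshelve. all: by end_near.
Qed.

End EntropyZero.

Theorem theorem5p8 (R : realType) :
  (forall f : R -> R, selfmapI f -> top_transitive (fun _ => f) ->
     forall a : nat -> nat, strict_incr a ->
       seq_entropy a (fun _ => hat f) = +oo%E) /\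
  (exists fs : nat -> R -> R,
     (forall n, selfmapI (fs n)) /\ top_transitive fs /\
     exists a : nat -> nat, strict_incr a /\
       seq_entropy a (fun n => hat (fs n)) = 0%E).
Proof.
split; first by move=> f sf tf a; exact: transitive_seq_entropy.
exists (@there_and_back R); split; first exact: there_and_back_selfmap.
split; first exact: there_and_back_transitive.
(* Even times from 2 on: there the induced map is the restriction to [I01], while at time 0 it is
   the identity on set functions, which may differ from it. *)
exists (fun i => i.+1.*2); split; first by move=> n; rewrite ltn_double.
apply: (@seq_entropy_const _ _ _ (fun m B => m (@I01 R `&` B))); last exact: MI_restrict.
move=> i m; rewrite doubleS comp_seq_hat; last exact: there_and_back_selfmap.
apply/funext => B; congr m; apply/seteqP.
have back x : I01 x -> comp_seq (@there_and_back R) i.*2.+2 x = x.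
  exact: there_and_back_even i.+1 x.
by split => x [xI Bx]; split => //; move: Bx; rewrite /preimage/mkset back.
Qed.
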